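(* Let $\epsilon>0$ be fixed. There is a deterministic LOCAL algorithm that, on any instance $(G=(L\cup R,E),\mathsf{C})$ of the allocation problem whose graph $G$ has arboricity $\lambda$, computes a $(2+\epsilon)$-approximate fractional allocation, i.e. a fractional allocation of weight at least $OPT/(2+\epsilon)$, where $OPT$ is the maximum weight of a fractional allocation, in $O_\epsilon(\log\lambda)$ rounds.
   Context: Allocation instance: a bipartite graph $G=(L\cup R,E)$ with known bipartition and integer capacities $\mathsf{C}_v\ge1$ for $v\in R$. A fractional allocation assigns to each edge $(u,v)\in E$ (with $u\in L$, $v\in R$) a value $\mathsf{x}_{u,v}\in[0,1]$ such that $\sum_{v\in \mathsf{N}_u}\mathsf{x}_{u,v}\le 1$ for every $u\in L$ and $\sum_{u\in\mathsf{N}_v}\mathsf{x}_{u,v}\le \mathsf{C}_v$ for every $v\in R$ ($\mathsf{N}_w$ denotes the neighborhood of $w$); its weight is $\sum_{(u,v)\in E}\mathsf{x}_{u,v}$. The arboricity $\lambda$ of $G$ is the minimum number of forests into which $E$ can be partitioned. LOCAL model: the communication network is $G$; each vertex has a processor with unbounded memory and a unique $O(\log n)$-bit identifier; in each synchronous round every vertex receives messages from the previous round, performs arbitrary computation, and sends arbitrary-size messages to its neighbors. $O_\epsilon(\cdot)$ hides factors depending only on $\epsilon$. *)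

(* Defs.v *)
From HB Require Import structures.
From mathcomp Require Import all_boot all_order all_algebra.
From mathcomp Require Import classical_sets reals exp.

Set Implicit Arguments.
Unset Strict Implicit.
Unset Printing Implicit Defensive.

Import Order.TTheory GRing.Theory Num.Theory.
Local Open Scope ring_scope.

Record allocation_instance : Type := AllocationInstance {
  sideL : finType;
  sideR : finType;
  edges : {set sideL * sideR};
  capacity : sideR -> nat;
  capacity_ge1 : forall v, (1 <= capacity v)%N
}.

Definition vertex (G : allocation_instance) : finType :=
  (sideL G + sideR G)%type.

Definition adjacent (TL TR : finType) (F : {set TL * TR}) : rel (TL + TR) :=
  fun a b => match a, b with
             | inl u, inr v => (u, v) \in F
             | inr v, inl u => (u, v) \in F
             | _, _ => false
             end.

(* A closed walk without repeated vertices is a genuine cycle only when it has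
   at least three vertices: [:: a; b] goes back and forth along one edge. *)
Definition is_forest (TL TR : finType) (F : {set TL * TR}) : Prop :=
  forall s : seq (TL + TR), ucycle (adjacent F) s -> (size s <= 2)%N.

Definition forest_partition (TL TR : finType) (E : {set TL * TR}) (k : nat) :
    Prop :=
  exists P : {set {set TL * TR}},
    [/\ finset.partition P E, forall F, F \in P -> is_forest F & #|P| = k].

Definition has_arboricity (G : allocation_instance) (lam : nat) : Prop :=
  forest_partition (edges G) lam /\
  forall k, forest_partition (edges G) k -> (lam <= k)%N.

Section FractionalAllocation.
Variables (R : realType) (G : allocation_instance).

(* Only the values of [x] on the edges of [G] are meaningful. *)
Definition is_fractional_allocation (x : sideL G -> sideR G -> R) : Prop :=
  [/\ forall u v, (u, v) \in edges G -> 0 <= x u v <= 1,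
      forall u, \sum_(v | (u, v) \in edges G) x u v <= 1
    & forall v, \sum_(u | (u, v) \in edges G) x u v <= (capacity v)%:R].

Definition weight (x : sideL G -> sideR G -> R) : R :=
  \sum_(e in edges G) x e.1 e.2.

(* The set is nonempty, bounded and compact, so this supremum is a maximum. *)
Definition OPT : R :=
  sup [set weight x | x in is_fractional_allocation]%classic.

End FractionalAllocation.

(* Identifiers are distinct and below n ^ c, i.e. of c * log2 n bits. *)
Definition valid_ids (c : nat) (G : allocation_instance) (id : vertex G -> nat) :
    Prop :=
  injective id /\ forall a, (id a < #|vertex G| ^ c)%N.

(* The program run by every processor of a deterministic LOCAL algorithm:
   - [init inp i] is the initial state of the vertex with identifier [i]; [inp]
     is [None] for a vertex of L and [Some C_v] for a vertex v of R;
   - [send s j] is the message sent in state [s] to the neighbour with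
     identifier [j];
   - [recv s ms] is the state entered from [s] upon receiving [ms], the messages
     of all the neighbours, each tagged with the identifier of its sender;
   - [output s j] is the value which a vertex in state [s] announces for the
     edge to its neighbour with identifier [j].
   A vertex is not told the identifiers of its neighbours beforehand. As message
   sizes are unbounded, addressing messages by identifier is the same as
   broadcasting the whole table [send s]. *)
Record local_algorithm (R : realType) : Type := LocalAlgorithm {
  state : Type;
  message : Type;
  init : option nat -> nat -> state;
  send : state -> nat -> message;
  recv : state -> seq (nat * message) -> state;
  output : state -> nat -> R
}.

Section Execution.
Variables (R : realType) (A : local_algorithm R).
Variables (G : allocation_instance) (id : vertex G -> nat).

Definition local_input (a : vertex G) : option nat :=
  match a with
  | inl _ => None
  | inr v => Some (capacity v)
  end.

(* Sorting by identifier keeps the enumeration order of the type of vertices,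
   which is not available to the processors, out of the execution. *)
Definition neighbors (a : vertex G) : seq (vertex G) :=
  sort (fun b b' => (id b <= id b')%N)
       (enum [pred b : vertex G | adjacent (edges G) a b]).

Fixpoint run (t : nat) : vertex G -> state A :=
  match t with
  | 0%N => fun a => init A (local_input a) (id a)
  | t'.+1 => fun a =>
      recv (run t' a) [seq (id b, send (run t' b) (id a)) | b <- neighbors a]
  end.

(* Both endpoints of an edge know its value. *)
Definition computes (t : nat) (x : sideL G -> sideR G -> R) : Prop :=
  forall u v, (u, v) \in edges G ->
    output (run t (inl u)) (id (inr v)) = x u v /\
    output (run t (inr v)) (id (inl u)) = x u v.

End Execution.

(* Main.v *)
Require Import Defs.
From HB Require Import structures.
From mathcomp Require Import all_boot all_order all_algebra.
From mathcomp Require Import lra.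
From mathcomp Require Import classical_sets reals exp.

Set Implicit Arguments.
Unset Strict Implicit.
Unset Printing Implicit Defensive.

Import Order.TTheory GRing.Theory Num.Theory.
Local Open Scope ring_scope.

(* Proportional allocation with monotone priorities. Every v in R has a priority,
   initially 1, and every u in L splits its unit among its neighbours in
   proportion to their priorities; v multiplies its priority by 1 + d as long as
   it receives at most C_v. After t steps, vertices of R with priority below
   (1 + d)^t receive at least C_v / (1 + d), and those with priority above 1 at
   most (1 + d) C_v. Truncate what v receives to C_v and let w be the resulting
   weight. The vertices of R with priority below (1 + d)^t, together with the
   neighbours A of the remaining ones, cover all edges. The former have total
   capacity at most (1 + d) w. A vertex of A sends at most (1 + d)^-t to each
   neighbour with priority 1, and a graph of arboricity lam has at most
   lam (|X| + |Y|) edges between X and Y; so once (1 + d)^t >= lam / d all but a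
   fraction O(d) of |A| reaches vertices that are not overfull, and
   |A| <= (1 + O(d)) w. By LP duality OPT <= (2 + 6 d) w. *)

(* Extend a path at its head: the new neighbour cannot lie on the path, since it
   would close a cycle of length at least three. *)
Lemma no_leaf_long_path (T : finType) (e : rel T) (x0 y0 : T) :
    symmetric e -> irreflexive e -> e x0 y0 ->
    (forall s, ucycle e s -> (size s <= 2)%N) ->
    (forall x y, e x y -> exists2 z, e x z & z != y) ->
  forall n, exists x p, [/\ path e x p, uniq (x :: p) & size p = n.+1].
Proof.
move=> sym irr e0 acyc noleaf; elim=> [|n [x [p [xp up sp]]]].
  exists x0, [:: y0]; rewrite /= e0 inE; split => //.
  by rewrite andbT; apply: contraTneq e0 => ->; rewrite irr.
case: p xp up sp => [//|y q] xp up sp.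
have exy : e x y by case/andP: xp.
have [z exz zy] := noleaf _ _ exy.
have zx : z != x by apply: contraTneq exz => ->; rewrite irr.
have [zp|zp] := boolP (z \in y :: q); last first.
  exists z, [:: x, y & q]; split; last by rewrite -sp.
    by rewrite /= sym exz.
  by rewrite cons_uniq up andbT inE negb_or zx.
have zq : z \in q by move: zp; rewrite inE (negPf zy).
case/splitPr: zq xp up sp zp => p1 p2 xp up _ _.
suff /acyc : ucycle e (x :: y :: rcons p1 z) by rewrite /= size_rcons.
apply/andP; split.
  rewrite (cycle_path x) /= last_rcons sym exz /=.
  by move: xp; rewrite -cat_rcons /= cat_path => /andP[-> /andP[-> _]].
by move: up; rewrite -cat_rcons -!cat_cons cat_uniq => /andP[-> _].
Qed.

(** * Edge counts of bipartite forests and of graphs of bounded arboricity *)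

Section ForestSize.
Variables TL TR : finType.
Implicit Types F : {set TL * TR}.

Lemma adjacent_sym F : symmetric (adjacent F).
Proof. by case=> [a|a] []. Qed.

Lemma adjacent_irr F : irreflexive (adjacent F).
Proof. by case. Qed.

Lemma is_forestS F F' : F' \subset F -> is_forest F -> is_forest F'.
Proof.
move=> /fintype.subsetP sF fF s /andP[cs us]; apply: fF; rewrite /ucycle us andbT.
apply: sub_cycle cs => -[a|a] [b|b] //=; exact: sF.
Qed.

(** Without a leaf every edge could be continued past its end, and paths would outgrow the number of
    vertices. *)
Lemma forest_leaf F : is_forest F -> F != finset.set0 ->
  exists a b, adjacent F a b /\ forall c, adjacent F a c -> c = b.
Proof.
move=> fF /set0Pn[[u v] uvF].
pose leaf a := [exists b, adjacent F a b && [forall c, adjacent F a c ==> (c == b)]].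
have [/existsP[a /existsP[b /andP[ab /forallP h]]]|/existsPn noleaf] :=
  boolP [exists a, leaf a].
  by exists a, b; split => // c; move/implyP: (h c) => /[apply] /eqP.
have nl x y : adjacent F x y -> exists2 z, adjacent F x z & z != y.
  move=> xy; move: (noleaf x) => /existsPn/(_ y); rewrite xy /=.
  by move=> /forallPn[z]; rewrite negb_imply => /andP[? ?]; exists z.
have uv : adjacent F (inl u) (inr v) by [].
have [x [p [_ up sp]]] :=
  no_leaf_long_path (@adjacent_sym F) (@adjacent_irr F) uv fF nl #|{: TL + TR}|.
have := max_card [in x :: p]; rewrite (card_uniqP up) /= sp => h.
by have := leq_trans (leqnSn _) h; rewrite ltnn.
Qed.

(** Induction on the number of edges: delete a leaf from its side, together with its only edge. *)
Lemma forest_card (A : {set TL}) (B : {set TR}) F :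
  is_forest F -> F \subset finset.setX A B -> (#|F| <= #|A| + #|B|)%N.
Proof.
have [n] := ubnP #|F|; elim: n => // n IH in A B F *; rewrite ltnS => Fn fF sF.
have [->|F0] := eqVneq F finset.set0; first by rewrite cards0.
have [a [b [ab leaf]]] := forest_leaf fF F0.
have step u v A' B' : (u, v) \in F -> F :\ (u, v) \subset finset.setX A' B' ->
    (#|F|.-1 <= #|A'| + #|B'|)%N.
  move=> uvF sF'; have := cardsD1 (u, v) F; rewrite uvF => cF; rewrite cF.
  by apply: IH sF'; [by move: Fn; rewrite cF | exact: is_forestS (subD1set _ _) fF].
have Fgt0 : (0 < #|F|)%N by rewrite card_gt0.
rewrite -(ltn_predK Fgt0).
move/fintype.subsetP: sF => sF.
case: a b ab leaf => [u|v] [w|w] //= uvF leaf.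
  have := sF _ uvF; rewrite inE => /andP[/= uA _].
  rewrite (cardsD1 u A) uA; apply: (step u w) => //.
  apply/fintype.subsetP => -[u' v']; rewrite !inE => /andP[ne /[dup] inF /sF].
  rewrite inE => /andP[/= -> ->]; rewrite !andbT; apply: contra ne => /eqP eu.
  by move: inF; rewrite eu => /(leaf (inr v')) [->].
have := sF _ uvF; rewrite inE => /andP[/= _ vB].
rewrite (cardsD1 v B) vB addnCA; apply: (step w v) => //.
apply/fintype.subsetP => -[u' v']; rewrite !inE => /andP[ne /[dup] inF /sF].
rewrite inE => /andP[/= -> ->]; rewrite !andbT; apply: contra ne => /eqP ev.
by move: inF; rewrite ev => /(leaf (inl u')) [->].
Qed.

Lemma forest_partition_card (E : {set TL * TR}) k (A : {set TL}) (B : {set TR}) :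
  forest_partition E k -> (#|E :&: finset.setX A B| <= k * (#|A| + #|B|))%N.
Proof.
case=> P [PE fP <-]; rewrite -sum1_card -sum_nat_const.
rewrite (eq_bigl (fun e => (e \in E) && (e \in finset.setX A B))); last by move=> e; rewrite inE.
rewrite (finset.set_partition_big_cond _ PE) /=; apply: leq_sum => F FP.
rewrite (eq_bigl (mem (F :&: finset.setX A B))); last by move=> e; rewrite !inE.
rewrite sum1_card; apply: forest_card (finset.subsetIr _ _).
exact: is_forestS (finset.subsetIl _ _) (fP _ FP).
Qed.

End ForestSize.

(** * The priority dynamics and its approximation ratio *)

Section ProportionalAllocation.
Variables (R : realType) (G : allocation_instance) (d : R).
Hypothesis d0 : 0 < d.
Local Notation E := (edges G).
Local Notation C v := ((capacity v)%:R : R).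

Definition priority_sum (beta : sideR G -> R) u := \sum_(v | (u, v) \in E) beta v.

Definition alloc (beta : sideR G -> R) v :=
  \sum_(u | (u, v) \in E) beta v / priority_sum beta u.

Fixpoint priority (t : nat) : sideR G -> R :=
  if t is t'.+1 then fun v =>
    if alloc (priority t') v <= C v then (1 + d) * priority t' v
    else priority t' v
  else fun=> 1.

(** The last factor truncates the load of [v] to [C v]. Division by a zero load makes it [0], which
    is harmless as [v] then receives nothing anyway. *)
Definition scaled (beta : sideR G -> R) u v :=
  beta v / priority_sum beta u * Num.min 1 (C v / alloc beta v).

Lemma priority_ge1 t v : 1 <= priority t v.
Proof.
elim: t v => //= t IH v; case: ifP => // _; have p1 := IH v; have hd := d0; nra.
Qed.

Lemma priority_gt0 t v : 0 < priority t v.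
Proof. exact: lt_le_trans (priority_ge1 t v). Qed.

Lemma priority_mono t v :
  priority t v <= priority t.+1 v <= (1 + d) * priority t v.
Proof. by have /= := priority_gt0 t v; have hd := d0; case: ifP => _ ?; apply/andP; split; nra. Qed.

Lemma priority_leX t v : priority t v <= (1 + d) ^+ t.
Proof.
elim: t => [|t IH]; first by rewrite expr0.
have /andP[_ /le_trans->] := priority_mono t v => //.
by rewrite exprS ler_pM2l // addr_gt0.
Qed.

Section Scaling.
Variable beta : sideR G -> R.
Hypothesis beta0 : forall v, 0 < beta v.

Lemma le_priority_sum u v : (u, v) \in E -> beta v <= priority_sum beta u.
Proof.
move=> uv; rewrite /priority_sum (bigD1 v) //= lerDl sumr_ge0 // => w _; exact: ltW.
Qed.

Lemma priority_sum_gt0 u v : (u, v) \in E -> 0 < priority_sum beta u.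
Proof. by move=> /le_priority_sum; apply: lt_le_trans. Qed.

Lemma share_ge0 u v : 0 <= beta v / priority_sum beta u.
Proof. by rewrite divr_ge0 ?sumr_ge0 // => [|w _]; apply: ltW. Qed.

Lemma share_le1 u v : (u, v) \in E -> beta v / priority_sum beta u <= 1.
Proof. by move=> uv; rewrite ler_pdivrMr ?(priority_sum_gt0 uv) // mul1r le_priority_sum. Qed.

Lemma sum_share u v : (u, v) \in E ->
  \sum_(w | (u, w) \in E) beta w / priority_sum beta u = 1.
Proof. by move=> uv; rewrite -mulr_suml divff // gt_eqF ?(priority_sum_gt0 uv). Qed.

Lemma alloc_ge0 v : 0 <= alloc beta v.
Proof. by apply: sumr_ge0 => u _; apply: share_ge0. Qed.

Lemma scaled_column v :
  \sum_(u | (u, v) \in E) scaled beta u v = Num.min (alloc beta v) (C v).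
Proof.
rewrite -mulr_suml -/(alloc beta v); have := alloc_ge0 v.
rewrite le0r => /orP[/eqP->|a0]; first by rewrite mul0r min_l ?ler0n.
by rewrite minr_pMr ?ltW // mulr1 mulrC divfK // gt_eqF.
Qed.

Lemma scaled_itv u v : 0 <= scaled beta u v <= beta v / priority_sum beta u.
Proof.
have s0 := share_ge0 u v; rewrite mulr_ge0 //; last first.
  by rewrite le_min ler01 divr_ge0 ?ler0n ?alloc_ge0.
by rewrite ler_piMr // ge_min lexx.
Qed.

Lemma scaled_allocation : is_fractional_allocation (scaled beta).
Proof.
split=> [u v uv|u|v]; last by rewrite scaled_column ge_min lexx orbT.
  by have /andP[-> /le_trans-> //] := scaled_itv u v; apply: share_le1.
have [v uv|nou] := pickP (fun v => (u, v) \in E); last by rewrite big_pred0.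
rewrite -(sum_share uv); apply: ler_sum => w _.
by have /andP[] := scaled_itv u w.
Qed.

Lemma weight_scaled :
  weight (scaled beta) = \sum_v Num.min (alloc beta v) (C v).
Proof.
under eq_bigr do rewrite -scaled_column.
rewrite (exchange_big_dep xpredT) //= pair_big_dep /=.
by apply: eq_bigl => -[u v].
Qed.

End Scaling.

(** Numerator and denominator each grow by a factor between [1] and [1 + d]; the bounds combine the
    extreme cases. *)
Lemma share_step t u v : (u, v) \in E ->
  [/\ priority t v / priority_sum (priority t) u <=
        (1 + d) * (priority t.+1 v / priority_sum (priority t.+1) u),
      priority t.+1 v = priority t v ->
        priority t.+1 v / priority_sum (priority t.+1) u <=
          priority t v / priority_sum (priority t) u,
      priority t.+1 v = (1 + d) * priority t v ->
        priority t v / priority_sum (priority t) u <=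
          priority t.+1 v / priority_sum (priority t.+1) u
    & priority t.+1 v / priority_sum (priority t.+1) u <=
        (1 + d) * (priority t v / priority_sum (priority t) u)].
Proof.
move=> uv.
have S0 := priority_sum_gt0 (priority_gt0 t) uv.
have S0' := priority_sum_gt0 (priority_gt0 t.+1) uv.
have b0 := priority_gt0 t v.
have /andP[b1 b2] := priority_mono t v.
have S1 : priority_sum (priority t) u <= priority_sum (priority t.+1) u.
  by apply: ler_sum => w _; have /andP[] := priority_mono t w.
have S2 : priority_sum (priority t.+1) u <= (1 + d) * priority_sum (priority t) u.
  by rewrite mulr_sumr; apply: ler_sum => w _; have /andP[] := priority_mono t w.
have I1 : (priority_sum (priority t.+1) u)^-1 <= (priority_sum (priority t) u)^-1.
  by rewrite lef_pV2.
have I2 : (priority_sum (priority t) u)^-1 <= (1 + d) * (priority_sum (priority t.+1) u)^-1.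
  by rewrite ler_pdivlMr // mulrC ler_pdivrMr.
move: S0 S0' b0; rewrite -invr_gt0 -[0 < priority_sum (priority t.+1) u]invr_gt0.
move=> /ltW S0 /ltW S0' /ltW b0; split=> [|->|->|].
- by rewrite mulrCA; apply: ler_pM.
- exact: ler_pM.
- by rewrite -mulrA mulrCA; apply: ler_pM.
- by rewrite mulrA; apply: ler_pM => //; apply: le_trans b1.
Qed.

Lemma alloc_step t v :
  [/\ alloc (priority t) v <= (1 + d) * alloc (priority t.+1) v,
      priority t.+1 v = priority t v ->
        alloc (priority t.+1) v <= alloc (priority t) v,
      priority t.+1 v = (1 + d) * priority t v ->
        alloc (priority t) v <= alloc (priority t.+1) v
    & alloc (priority t.+1) v <= (1 + d) * alloc (priority t) v].
Proof.
by rewrite /alloc !mulr_sumr; split=> [|e|e|]; apply: ler_sum => u /(share_step t)[] *; auto.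
Qed.

(* A priority below its maximum was once left alone, so [v] was then full; a
   priority above 1 was once raised, so [v] was then not overfull. One step costs
   at most a factor [1 + d], and the allocation does not decrease while the priority
   is raised and does not increase while it is left alone. *)
Lemma alloc_near_capacity t v :
  (priority t v < (1 + d) ^+ t -> C v <= (1 + d) * alloc (priority t) v) /\
  (1 < priority t v -> alloc (priority t) v <= (1 + d) * C v).
Proof.
elim: t => [|t [IHl IHu]]; first by rewrite expr0 ltxx.
have [dn dn' up up'] := alloc_step t v.
have hd := d0; have C0 : 0 <= C v by exact: ler0n.
have a0 := alloc_ge0 (priority_gt0 t) v.
have a0' := alloc_ge0 (priority_gt0 t.+1) v.
have : priority t.+1 v = if alloc (priority t) v <= C v
  then (1 + d) * priority t v else priority t v by [].
case: ifP => [aC|/negbT aC] pE.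
  have {}up := up pE; rewrite {1}pE exprS ltr_pM2l ?addr_gt0 //.
  split=> [/IHl h|_]; last by apply: le_trans up' _; rewrite ler_pM2l ?addr_gt0.
  by apply: le_trans h _; rewrite ler_pM2l ?addr_gt0.
rewrite -ltNge in aC; split=> [_|]; first exact: le_trans (ltW aC) dn.
by rewrite {1}pE => /IHu; apply: le_trans; apply: dn'.
Qed.

(** Weak LP duality: charge each edge to its endpoints in the cover, whose loads are bounded by the
    constraints. *)
Lemma weight_le_cover (x : sideL G -> sideR G -> R) (A : {set sideL G})
    (B : {set sideR G}) :
  is_fractional_allocation x ->
  (forall u v, (u, v) \in E -> (u \in A) || (v \in B)) ->
  weight x <= #|A|%:R + \sum_(v in B) C v.
Proof.
case=> x01 xL xR cov.
have x0 u v : (u, v) \in E -> 0 <= x u v by move=> /x01/andP[].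
apply: (@le_trans _ _ (\sum_(e in E | e.1 \in A) x e.1 e.2 +
                       \sum_(e in E | e.2 \in B) x e.1 e.2)).
  rewrite /weight !big_mkcondr -big_split /=; apply: ler_sum => -[u v] /= uv.
  by have := cov _ _ uv; have := x0 _ _ uv; do 2!case: ifP => //=; lra.
apply: lerD.
  rewrite -sumr_const; apply: (@le_trans _ _ (\sum_(u in A) \sum_(v | (u, v) \in E) x u v)).
    rewrite pair_big_dep le_eqVlt; apply/orP; left; apply/eqP.
    by apply: eq_bigl => -[u v] /=; rewrite andbC.
  by apply: ler_sum => u _; apply: xL.
apply: (@le_trans _ _ (\sum_(v in B) \sum_(u | (u, v) \in E) x u v)).
  rewrite (exchange_big_dep xpredT) //= pair_big_dep le_eqVlt; apply/orP; left; apply/eqP.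
  by apply: eq_bigl => -[u v] /=; rewrite andbC.
by apply: ler_sum => v _; apply: xR.
Qed.

Lemma OPT_le_cover (A : {set sideL G}) (B : {set sideR G}) :
  (forall u v, (u, v) \in E -> (u \in A) || (v \in B)) ->
  OPT R G <= #|A|%:R + \sum_(v in B) C v.
Proof.
move=> cov; apply: ge_sup; last by move=> _ [x xa <-]; apply: weight_le_cover.
(* The zero allocation shows that the supremum is over a nonempty set. *)
exists (weight (G := G) (fun _ _ => 0 : R)), (fun _ _ => 0) => //.
by split=> [u v _|u|v]; rewrite ?big1 ?ler0n ?lexx ?ler01.
Qed.

Lemma OPT_le_weight_scaled t lam :
  (0 < t)%N -> d <= 3^-1 -> lam%:R <= d * (1 + d) ^+ t ->
  forest_partition E lam ->
  OPT R G <= (2 + 6 * d) * weight (scaled (priority t)).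
Proof.
move=> t0 d3 lamd part; have hd := d0.
have X0 : 0 < (1 + d) ^+ t by rewrite exprn_gt0 // addr_gt0.
have X1 : 1 < (1 + d) ^+ t by rewrite exprn_egt1 -?lt0n // ltrDl.
rewrite weight_scaled; last exact: priority_gt0.
set p := priority t; set w := \sum_v _.
have p0 : forall v, 0 < p v := priority_gt0 t.
have m0 v : 0 <= Num.min (alloc p v) (C v) by rewrite le_min alloc_ge0 // ler0n.
have w_ge (P : pred (sideR G)) : \sum_(v | P v) Num.min (alloc p v) (C v) <= w.
  by rewrite /w (bigID P xpredT) /= lerDl sumr_ge0.
(* [A] and [B] form the vertex cover; only vertices of [L0] may be overfull by
   more than a factor [1 + d], and [A] sends almost nothing to them. *)
pose B := [set v | p v < (1 + d) ^+ t]; pose L0 := [set v | p v <= 1].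
pose A := [set u | [exists v, ((u, v) \in E) && (v \notin B)]].
have B_w : \sum_(v in B) C v <= (1 + d) * w.
  apply: le_trans (ler_wpM2l _ (w_ge (mem B))); last by rewrite addr_ge0 // ltW.
  rewrite mulr_sumr; apply: ler_sum => v; rewrite inE => vB.
  have [h _] := alloc_near_capacity t v; have {}h := h vB.
  have C0 : 0 <= C v by exact: ler0n.
  by rewrite -/p in h; rewrite /Num.min; case: ifP => _; nra.
(* As [0 < t], [L0] lies inside [B], and each capacity is at least [1]. *)
have L0_B : #|L0|%:R <= \sum_(v in B) C v.
  apply: (@le_trans _ _ #|B|%:R).
    rewrite ler_nat; apply/subset_leq_card/fintype.subsetP => v.
    by rewrite !inE => /le_lt_trans; apply.
  rewrite -sumr_const; apply: ler_sum => v _; rewrite ler1n; exact: capacity_ge1.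
have upper_w : \sum_(v | v \notin L0) alloc p v <= (1 + d) * w.
  apply: le_trans (ler_wpM2l _ (w_ge (fun v => v \notin L0))); last by rewrite addr_ge0 // ltW.
  rewrite mulr_sumr; apply: ler_sum => v; rewrite inE -ltNge => vL.
  have [_ h] := alloc_near_capacity t v; have {}h := h vL.
  have a0 : 0 <= alloc p v by exact: alloc_ge0.
  by rewrite -/p in h; rewrite /Num.min; case: ifP => _; nra.
(* A vertex of [A] has a neighbour of maximal priority, so each of its shares to [L0] is at most
   [(1 + d) ^- t]; the arboricity bounds the number of these shares. *)
have low : \sum_(u in A) \sum_(v | ((u, v) \in E) && (v \in L0)) p v / priority_sum p u
    <= d * (#|A|%:R + #|L0|%:R).
  apply: (@le_trans _ _ (#|E :&: finset.setX A L0|%:R / (1 + d) ^+ t)).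
    rewrite pair_big_dep mulr_natl -sumr_const /=.
    rewrite (eq_bigl (mem (E :&: finset.setX A L0))); last first.
      by case=> u v; rewrite !inE /= andbCA.
    apply: ler_sum => -[u v]; rewrite !inE /= => /and3P[_ /existsP[z]].
    rewrite inE -leNgt => /andP[uz zt] pv1.
    have S0 := priority_sum_gt0 p0 uz.
    rewrite ler_pdivrMr // mulrC ler_pdivlMr //.
    apply: (@le_trans _ _ ((1 + d) ^+ t)); first by rewrite ler_piMl // ltW.
    exact: le_trans zt (le_priority_sum p0 uz).
  rewrite ler_pdivrMr // mulrAC -natrD.
  apply: le_trans (ler_wpM2r (ler0n _ _) lamd).
  by rewrite -natrM ler_nat forest_partition_card.
(* Each vertex of [A] sends out exactly one unit; split it by whether the receiver is in [L0]. *)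
have A_w : #|A|%:R <= (1 + d) * w + d * (#|A|%:R + #|L0|%:R).
  apply: le_trans (lerD upper_w low).
  rewrite -sumr_const.
  have -> : \sum_(u in A) (1 : R) = \sum_(u in A)
      (\sum_(v | ((u, v) \in E) && (v \notin L0)) p v / priority_sum p u +
       \sum_(v | ((u, v) \in E) && (v \in L0)) p v / priority_sum p u).
    apply: eq_bigr => u; rewrite inE => /existsP[z /andP[uz _]].
    by rewrite addrC -(sum_share p0 uz) [LHS](bigID (mem L0)).
  rewrite big_split lerD2r /= (exchange_big_dep (fun v => v \notin L0)) /=; last first.
    by move=> u v _ /andP[].
  apply: ler_sum => v vL; rewrite /alloc [leRHS](bigID (mem A)) /=.
  rewrite (eq_bigl (fun u => ((u, v) \in E) && (u \in A))); last first.
    by move=> u; rewrite vL andbT andbC.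
  by rewrite lerDl sumr_ge0 // => u _; apply: share_ge0.
have w0 : 0 <= w by apply: sumr_ge0.
have : OPT R G <= #|A|%:R + \sum_(v in B) C v.
  apply: OPT_le_cover => u v uv.
  have [//|vB] := boolP (v \in B); first by rewrite orbT.
  by rewrite orbF inE; apply/existsP; exists v; rewrite uv.
clear w_ge upper_w low; move: (OPT R G) B_w L0_B A_w w0.
move: (#|A|%:R : R) (#|L0|%:R : R) (\sum_(v in B) C v) w => a l b w' O Bw LB Aw w0 Oab.
(* Twice this quantity is the slack [(1 - d) * (1 + 5 * d) - (1 + d) ^+ 2] times [w']; [d <= 3^-1]
   makes it nonnegative. *)
have dw : 0 <= d * (1 - 3 * d) * w'.
  by rewrite !mulr_ge0 ?(ltW hd) //; lra.
have bd : d * b <= d * ((1 + d) * w') by rewrite ler_pM2l.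
have ld : d * l <= d * b by rewrite ler_pM2l.
have : (1 - d) * a <= (1 - d) * ((1 + 5 * d) * w') by lra.
by rewrite ler_pM2l => [|]; lra.
Qed.

End ProportionalAllocation.

(** * The dynamics as a LOCAL algorithm *)

Record processor (R : realType) : Type := Processor {
  role : option nat;
  phase : bool;
  value : R;
  table : nat -> R
}.

(* One step of the dynamics takes two rounds: at even times the vertices of L
   collect the priorities of their neighbours, at odd times the vertices of R
   collect the resulting totals. A message carries the current value together
   with the table entry for its addressee, through which L learns the value that
   R has computed for their common edge. *)
Definition allocation_recv (R : realType) (d : R) (s : processor R)
    (ms : seq (nat * (R * R))) : processor R :=
  match role s, phase s with
  | None, false =>
      Processor None true (\sum_(m <- ms) m.2.1)
        (fun j => \sum_(m <- ms | m.1 == j) m.2.2)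
  | Some c, true =>
      let a := \sum_(m <- ms) value s / m.2.1 in
      Processor (Some c) false
        (if a <= c%:R then (1 + d) * value s else value s)
        (fun j => \sum_(m <- ms | m.1 == j)
                    value s / m.2.1 * Num.min 1 (c%:R / a))
  | r, b => Processor r (~~ b) (value s) (table s)
  end.

Definition allocation_algorithm (R : realType) (d : R) : local_algorithm R :=
  LocalAlgorithm (fun inp _ => Processor inp false 1 (fun=> 0))
    (fun s j => (value s, table s j)) (allocation_recv d) (fun s j => table s j).

Section Execution.
Variables (R : realType) (d : R) (G : allocation_instance) (id : vertex G -> nat).
Hypothesis id_inj : injective id.
Local Notation E := (edges G).
Local Notation state_at t a := (run (allocation_algorithm d) id t a).
Local Notation beta := (@priority R G d).

(** Sorting by identifier only permutes the terms of the sum. *)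
Lemma sum_neighbors (M : Type) (f : vertex G -> M) (P : pred nat)
    (F : M -> R) (a : vertex G) :
  \sum_(m <- [seq (id b, f b) | b <- neighbors id a] | P m.1) F m.2 =
  \sum_(b | adjacent E a b && P (id b)) F (f b).
Proof.
rewrite big_map /neighbors /=.
rewrite (perm_big _ (permEl (perm_sort _ _))) big_enum_cond.
by apply: eq_bigl => b; rewrite inE.
Qed.

Lemma sum_neighborsL (M : Type) (f : vertex G -> M) (F : M -> R) u :
  \sum_(m <- [seq (id b, f b) | b <- neighbors id (inl u)]) F m.2 =
  \sum_(v | (u, v) \in E) F (f (inr v)).
Proof.
rewrite (sum_neighbors f xpredT) big_sumType /= [X in X + _]big_pred0 // add0r.
by apply: eq_bigl => v; rewrite /= andbT.
Qed.

Lemma sum_neighborsR (M : Type) (f : vertex G -> M) (F : M -> R) v :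
  \sum_(m <- [seq (id b, f b) | b <- neighbors id (inr v)]) F m.2 =
  \sum_(u | (u, v) \in E) F (f (inl u)).
Proof.
rewrite (sum_neighbors f xpredT) big_sumType /= [X in _ + X]big_pred0 // addr0.
by apply: eq_bigl => u; rewrite /= andbT.
Qed.

(** Distinct identifiers leave a single term, so the filtered sum acts as a table lookup. *)
Lemma lookup_neighbor (M : Type) (f : vertex G -> M) (F : M -> R) a b :
  adjacent E a b ->
  \sum_(m <- [seq (id b, f b) | b <- neighbors id a] | m.1 == id b) F m.2 =
  F (f b).
Proof.
move=> ab; rewrite (sum_neighbors f (pred1 (id b))) (big_pred1 b) // => c /=.
rewrite (inj_eq id_inj); case: eqP => [->|]; first by rewrite ab.
by rewrite andbF.
Qed.

Lemma role_phase t a :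
  role (state_at t a) = local_input a /\ phase (state_at t a) = odd t.
Proof.
elim: t a => //= t IH a; have [r p] := IH a.
by rewrite /allocation_recv r p; case: (local_input a); case: (odd t).
Qed.

Lemma valueL t u : ~~ odd t ->
  value (state_at t.+1 (inl u)) =
  \sum_(v | (u, v) \in E) value (state_at t (inr v)).
Proof.
move=> /negPf t2; have [r p] := role_phase t (inl u).
rewrite /= /allocation_recv r p t2 /=.
by rewrite (sum_neighborsL _ (fun m => m.1)).
Qed.

Lemma tableL t u v : ~~ odd t -> (u, v) \in E ->
  table (state_at t.+1 (inl u)) (id (inr v)) =
  table (state_at t (inr v)) (id (inl u)).
Proof.
move=> /negPf t2 uv; have [r p] := role_phase t (inl u).
rewrite /= /allocation_recv r p t2 /=.
by rewrite (lookup_neighbor _ (fun m => m.2)).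
Qed.

Lemma idleR t v : ~~ odd t ->
  value (state_at t.+1 (inr v)) = value (state_at t (inr v)) /\
  table (state_at t.+1 (inr v)) = table (state_at t (inr v)).
Proof.
move=> /negPf t2; have [r p] := role_phase t (inr v).
by rewrite /= /allocation_recv r p t2.
Qed.

Lemma stepR t v : odd t ->
  let b := value (state_at t (inr v)) in
  let a := \sum_(u | (u, v) \in E) b / value (state_at t (inl u)) in
  value (state_at t.+1 (inr v)) =
    (if a <= (capacity v)%:R then (1 + d) * b else b) /\
  forall u, (u, v) \in E ->
    table (state_at t.+1 (inr v)) (id (inl u)) =
    b / value (state_at t (inl u)) * Num.min 1 ((capacity v)%:R / a).
Proof.
move=> t2 b a; have [r p] := role_phase t (inr v).
rewrite /= /allocation_recv r p t2 /= -/b.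
rewrite (sum_neighborsR _ (fun m => b / m.1)) -/a; split=> // u uv.
by rewrite (lookup_neighbor _ (fun m => b / m.1 * Num.min 1 (_ / a))).
Qed.

Lemma value_run k :
  (forall v, value (state_at k.*2 (inr v)) = beta k v) /\
  (forall u, value (state_at k.*2.+1 (inl u)) = priority_sum (beta k) u).
Proof.
suff H : forall v, value (state_at k.*2 (inr v)) = beta k v.
  split=> // u; rewrite valueL ?odd_double //.
  by apply: eq_bigr => v _; apply: H.
elim: k => // k IH v; have e2 := negbT (odd_double k).
have [] := @stepR k.*2.+1 v e2; rewrite -doubleS => -> _.
have [-> _] := idleR v e2; rewrite IH [in RHS]/=.
rewrite (eq_bigr (fun u => beta k v / priority_sum (beta k) u)) // => u _.
by rewrite valueL // (eq_bigr (beta k)).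
Qed.

(** After [k] steps, two more rounds give the vertices of R the scaled values, and a third one
    passes these to L. *)
Lemma computes_scaled k :
  computes (allocation_algorithm d) id k.*2.+3 (scaled (beta k)).
Proof.
have e2 := negbT (odd_double k).
have e2' : ~~ odd k.*2.+2 by rewrite -doubleS odd_double.
have [vR vL] := value_run k.
move=> u v uv; suff H : table (state_at k.*2.+2 (inr v)) (id (inl u)) = scaled (beta k) u v.
  have [_ eR] := idleR v e2'.
  by split; rewrite -H; [apply: tableL | rewrite -eR].
have [_ ->//] := @stepR k.*2.+1 v e2.
have [-> _] := idleR v e2; rewrite vR vL /scaled; congr (_ * Num.min 1 (_ / _)).
by apply: eq_bigr => w _; rewrite vL.
Qed.

End Execution.

(** * The number of steps and the round bound *)

Definition steps (R : realType) (d : R) (lam : nat) : nat :=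
  (Num.truncn ((ln (lam%:R : R) - ln d) / ln (1 + d))).+1.

Lemma ln_nat_ge0 (R : realType) n : 0 <= ln (n%:R : R).
Proof.
case: n => [|n]; first by rewrite ln0.
by rewrite ln_ge0 // ler1n.
Qed.

Section Steps.
Variables (R : realType) (d : R).
Hypotheses (d0 : 0 < d) (d1 : d <= 1).

Lemma steps_pow lam : lam%:R <= d * (1 + d) ^+ steps d lam.
Proof.
(* [lam = 0] is treated apart, since [ln 0] is only a default value. *)
case: lam => [|lam]; first by rewrite mulr_ge0 ?exprn_ge0 ?addr_ge0 // ltW.
rewrite -ler_pdivrMl // mulrC.
have l0 : 0 < ln (1 + d) by rewrite ln_gt0 // ltrDl.
have q0 : 0 < lam.+1%:R / d by rewrite divr_gt0.
have X0 : 0 < (1 + d) ^+ steps d lam.+1 by rewrite exprn_gt0 // addr_gt0.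
rewrite -ler_ln ?posrE // lnXn ?addr_gt0 // ln_div ?posrE //.
rewrite -[leRHS]mulr_natl -ler_pdivrMr //; exact/ltW/truncnS_gt.
Qed.

(** The [5] collects the three extra rounds and the doubled successor in [steps]. *)
Lemma steps_le lam :
  (steps d lam).*2.+3%:R <=
  (5 + (2 - 2 * ln d) / ln (1 + d)) * (1 + ln (lam%:R : R)).
Proof.
have l0 : 0 < ln (1 + d) by rewrite ln_gt0 // ltrDl.
have n0 := ln_nat_ge0 R lam.
have ld : ln d <= 0 by rewrite ln_le0.
have i0 : 0 < (ln (1 + d))^-1 by rewrite invr_gt0.
have : (steps d lam)%:R <= (ln (lam%:R : R) - ln d) / ln (1 + d) + 1.
  rewrite /steps -natr1 lerD2r truncn_le divr_ge0 ?(ltW l0) //; lra.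
rewrite -addn3 natrD -mul2n natrM.
move: (steps d lam)%:R (ln (lam%:R : R)) n0 => s n n0.
move: (ln (1 + d))^-1 i0 => i i0 h.
have a1 : 0 <= n * i by rewrite mulr_ge0 // ltW.
have a2 : 0 <= n * i * - ln d by rewrite mulr_ge0 // oppr_ge0.
lra.
Qed.

End Steps.

Theorem theorem2 (R : realType) (eps : R) (heps : 0 < eps) :
  exists K : R, forall c : nat,
  exists (A : local_algorithm R) (T : nat -> nat),
    (forall lam : nat, (T lam)%:R <= K * (1 + ln (lam%:R : R))) /\
    forall (G : allocation_instance) (lam : nat) (id : vertex G -> nat),
      has_arboricity G lam -> valid_ids c id ->
      exists x : sideL G -> sideR G -> R,
        [/\ computes A id (T lam) x,
            is_fractional_allocation x
          & OPT R G / (2 + eps) <= weight x].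
Proof.
(* The summand [6] ensures [6 * d <= eps], and [3 * eps] ensures [d <= 3^-1]. *)
pose d := eps / (6 + 3 * eps).
have den0 : 0 < 6 + 3 * eps by lra.
have d0 : 0 < d by rewrite divr_gt0.
have d3 : d <= 3^-1 by rewrite ler_pdivrMr //; lra.
have d1 : d <= 1 by lra.
have d6 : 6 * d <= eps.
  by rewrite mulrA ler_pdivrMr //; have := mulr_gt0 heps heps; lra.
exists (5 + (2 - 2 * ln d) / ln (1 + d)) => c.
(* One program serves all arboricities; only its stopping time varies with [lam]. *)
exists (allocation_algorithm d), (fun lam => (steps d lam).*2.+3).
split=> [lam|G lam id [part _] [id_inj _]]; first exact: steps_le.
have p0 := @priority_gt0 R G d d0 (steps d lam).
exists (scaled (@priority R G d (steps d lam))); split.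
- exact: computes_scaled.
- exact: scaled_allocation.
- rewrite ler_pdivrMr ?addr_gt0 //.
  apply: le_trans (OPT_le_weight_scaled d0 _ d3 (steps_pow d0 lam) part) _ => //.
  rewrite mulrC ler_wpM2l //; last by rewrite lerD2l.
  rewrite weight_scaled //; apply: sumr_ge0 => v _.
  by rewrite le_min alloc_ge0 // ler0n.
Qed.
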